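(* The function $m\mapsto V(\bar M_m,\bar g_m)$ is strictly monotone increasing on $(0,\infty)$; that is, if $0<m_1<m_2$ then $V(\bar M_{m_1},\bar g_{m_1})<V(\bar M_{m_2},\bar g_{m_2})$.
   Context: For $m>0$ let $s_0(m)$ be the unique positive solution of $1+s_0^2-m\,s_0^{-1}=0$. The Anti-deSitter-Schwarzschild manifold $(\bar M_m,\bar g_m)$ is $\{s\ge s_0(m)\}\times S^2$ with the metric $\bar g_m=\frac{1}{1+s^2-m\,s^{-1}}\,ds\otimes ds+s^2 g_{S^2}$, where $g_{S^2}$ is the round metric on the unit sphere. Its renormalized volume (the limit over exhaustions of the difference between its volume and the volume in hyperbolic space) is $$V(\bar M_m,\bar g_m)=\lim_{r\to\infty}\Big(\int_{s_0(m)}^r\frac{4\pi s^2}{\sqrt{1+s^2-m\,s^{-1}}}\,ds-\int_0^r\frac{4\pi s^2}{\sqrt{1+s^2}}\,ds\Big).$$ *)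

(* Defs.v *)
From HB Require Import structures.
From mathcomp Require Import all_boot all_order all_algebra.
From mathcomp Require Import all_classical all_reals all_analysis.
From mathcomp Require Import ring lra.
Set Implicit Arguments.
Unset Strict Implicit.
Unset Printing Implicit Defensive.
Import Order.TTheory GRing.Theory Num.Theory.
Import numFieldNormedType.Exports.
Local Open Scope classical_set_scope.
Local Open Scope ring_scope.

Section AdSSchwarzschild.
Context {R : realType}.
Implicit Types m s r : R.

(* The metric is ds^2 / ads_potential m s + s^2 g_{S^2}. *)
Definition ads_potential m s : R := 1 + s ^+ 2 - m * s^-1.

(* s_0(m), by definite description; for 0 < m it is characterised by
   horizon_radiusP below. *)
Definition horizon_radius m : R :=
  xget 0 [set s | 0 < s /\ ads_potential m s = 0].

(* The integrals over the sphere have been carried out (the factors 4 * pi).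
   The first integrand is singular at s = horizon_radius m, where division by
   zero gives it the value 0; a single point is a null set. An infinite
   Lebesgue integral would be truncated to 0 here, but the difference would
   then tend to -oo: convergence of volume_excess m thus entails finiteness of
   the first integral for large r, hence for all r. *)
Definition volume_excess m r : R :=
  \int[lebesgue_measure]_(s in `[horizon_radius m, r])
     (4 * pi * s ^+ 2 / Num.sqrt (ads_potential m s))
  - \int[lebesgue_measure]_(s in `[0, r])
     (4 * pi * s ^+ 2 / Num.sqrt (1 + s ^+ 2)).

Definition renormalized_volume m : R :=
  lim (volume_excess m r @[r --> +oo]).

Lemma ads_potential_root_unique m s t : 0 < m -> 0 < s -> 0 < t ->
  ads_potential m s = 0 -> ads_potential m t = 0 -> s = t.
Proof.
have cubic u : 0 < u -> ads_potential m u = 0 -> u + u ^+ 3 = m.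
  move=> u0 hu; have un0 : u != 0 by rewrite gt_eqF.
  have -> : u + u ^+ 3 = ads_potential m u * u + m.
    by rewrite /ads_potential; field.
  by rewrite hu mul0r add0r.
move=> m0 s0 t0 /(cubic _ s0) hs /(cubic _ t0) ht.
have : (s - t) * (1 + s ^+ 2 + s * t + t ^+ 2) = 0.
  have -> : (s - t) * (1 + s ^+ 2 + s * t + t ^+ 2)
     = (s + s ^+ 3) - (t + t ^+ 3) by ring.
  by rewrite hs ht subrr.
move=> /eqP; rewrite mulf_eq0 subr_eq0 => /orP[/eqP//|/eqP h].
by have := mulr_gt0 s0 t0; have := sqr_ge0 s; have := sqr_ge0 t; lra.
Qed.

Lemma ads_potential_root_exists m : 0 < m ->
  exists s, 0 < s /\ ads_potential m s = 0.
Proof.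
move=> m0; pose p : {poly R} := 'X + 'X^3 - m%:P.
have pE x : p.[x] = x + x ^+ 3 - m by rewrite /p !hornerE.
have m3 : 0 <= m ^+ 3 by rewrite exprn_ge0 // ltW.
have [||s /andP[s0 _]] := @poly_ivt _ p 0 m; first exact: ltW.
  by rewrite !pE; apply/andP; split; lra.
rewrite rootE pE => /eqP hs.
have sn0 : s != 0.
  by apply/eqP => se; move: hs; rewrite se expr0n /=; lra.
exists s; split; first by rewrite lt_neqAle eq_sym sn0.
have -> : ads_potential m s = (s + s ^+ 3 - m) / s.
  by rewrite /ads_potential; field.
by rewrite hs mul0r.
Qed.

Lemma horizon_radiusP m s : 0 < m ->
  s = horizon_radius m <-> 0 < s /\ ads_potential m s = 0.
Proof.
move=> m0; have [t ht] := ads_potential_root_exists m0.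
have [h0 h] : [set s | 0 < s /\ ads_potential m s = 0] (horizon_radius m).
  exact: (xgetI 0 ht).
split=> [->//|[s0 hs]]; exact: (ads_potential_root_unique m0).
Qed.

End AdSSchwarzschild.

(* Main.v *)
Require Import Defs.
From mathcomp Require Import all_boot all_order all_algebra.
From mathcomp Require Import all_classical all_reals all_analysis.
From mathcomp Require Import measurable_realfun ring lra.
Import Order.TTheory GRing.Theory Num.Theory.
Import numFieldNormedType.Exports.
Local Open Scope classical_set_scope.
Local Open Scope ring_scope.

(** The horizon radius [a] of mass [m] solves [a + a^3 = m], and the factor
    [1 + s^2 - m/s] equals [(s + s^3 - m) / s].  The substitution
    [w = sqrt (s + s^3 - m)] (the shell parameter) therefore sends the horizon
    to [w = 0] and removes the singularity of the volume integrand: since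
    [2 w dw = (1 + 3 s^2) ds], the volume form [4 pi s^2 / sqrt (1 + s^2 - m/s) ds]
    becomes [F s dw] with [F s = 8 pi s^2 sqrt s / (1 + 3 s^2)].  Here [s] is
    the positive solution of [s + s^3 = w^2 + m], that is, the horizon radius
    of mass [w^2 + m].  At fixed [w] this [s] grows with [m], and [F] is
    strictly increasing ([radial_density_lt]), so the density in [w] is
    strictly increasing in [m] ([shell_density_lt]).

    If [Phi_m] is a primitive of that density, then the volume inside radius
    [r] is [Phi_m W_m - Phi_m 0], where [W_m = sqrt (r + r^3 - m)]
    ([volume_integralE]); hyperbolic space is the case [m = 0].  For [m1 < m2]
    the upper bounds differ, [W_m2 < W_m1], but the volume lost between them
    is [O(1/r)] ([shell_parameter_shift_le]), while
    [(Phi_m2 - Phi_m1) W - (Phi_m2 - Phi_m1) 0] increases with [W] and is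
    positive at [W = 1].  Hence the two volume excesses stay apart by a positive
    constant for large [r] ([volume_excess_gap]), which survives in the limit.

    The limit exists because in the variable [s] the two integrands differ by
    a quantity between [0] and [4 pi m / s^2] when [s > m], so that the excess
    is nondecreasing and bounded in [r] ([volume_excess_increment]). *)

Section RenormalizedVolume.
Context {R : realType}.
Implicit Types m s t w : R.

(** * The horizon radius as inverse of the cubic s + s^3 *)

(** [s + s^3] expands distances, so its inverse is 1-Lipschitz. *)
Lemma ler_cubicB s t : 0 <= s -> s <= t ->
  t - s <= (t + t ^+ 3) - (s + s ^+ 3).
Proof.
move=> s0 st; have : s ^+ 3 <= t ^+ 3 by rewrite lerXn2r// nnegrE; lra.
lra.
Qed.

(** Without a positive root the description falls back on its default 0.  This
    makes hyperbolic space the case of mass 0, and makes the horizon radius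
    continuous on the whole line. *)
Lemma horizon_radius_le0 m : m <= 0 -> horizon_radius m = 0.
Proof.
move=> m0; apply: xgetPN => s [s0 hs].
have si : 0 < s^-1 by rewrite invr_gt0.
have : m * s^-1 <= 0 by rewrite mulr_le0_ge0// ltW.
have := sqr_ge0 s; move: hs; rewrite /ads_potential; lra.
Qed.

Lemma horizon_radius_ge0 m : 0 <= horizon_radius m.
Proof.
have [/horizon_radius_le0->//|m0] := leP m 0.
by have [/ltW] := (horizon_radiusP (horizon_radius m) m0).1 erefl.
Qed.

Lemma ads_potentialE m s : 0 < s -> ads_potential m s = (s + s ^+ 3 - m) / s.
Proof. by move=> s0; rewrite /ads_potential; field; rewrite gt_eqF. Qed.

Lemma horizon_radius_cubic m :
  horizon_radius m + horizon_radius m ^+ 3 = Num.max 0 m.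
Proof.
have [m0|m0] := leP m 0; first by rewrite horizon_radius_le0// expr0n addr0.
have [s0] := (horizon_radiusP (horizon_radius m) m0).1 erefl.
rewrite ads_potentialE// => /eqP; rewrite mulf_eq0 invr_eq0 (gt_eqF s0) orbF.
by rewrite subr_eq0 => /eqP.
Qed.

Lemma cubic_horizon_radius s : 0 <= s -> horizon_radius (s + s ^+ 3) = s.
Proof.
move=> s0; have h0 := horizon_radius_ge0 (s + s ^+ 3).
have := horizon_radius_cubic (s + s ^+ 3).
rewrite max_r ?addr_ge0 ?exprn_ge0//.
have [hs|hs] := leP (horizon_radius (s + s ^+ 3)) s.
  have := ler_cubicB _ _ h0 hs; lra.
have := ler_cubicB _ _ s0 (ltW hs); lra.
Qed.

Lemma horizon_radius_continuous : continuous (@horizon_radius R).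
Proof.
have lip (x y : R) : x <= y -> `|horizon_radius x - horizon_radius y| <= y - x.
  move=> xy; have hx := horizon_radius_ge0 x; have hy := horizon_radius_ge0 y.
  have cx := horizon_radius_cubic x; have cy := horizon_radius_cubic y.
  have mono : Num.max 0 x <= Num.max 0 y <= Num.max 0 x + (y - x).
    by case: (leP 0 x); case: (leP 0 y) => *; apply/andP; split; lra.
  have [h|h] := leP (horizon_radius y) (horizon_radius x).
    have := ler_cubicB _ _ hy h; rewrite ger0_norm ?subr_ge0//; lra.
  have := ler_cubicB _ _ hx (ltW h); rewrite distrC gtr0_norm ?subr_gt0//; lra.
move=> x; apply/cvgrPdist_le => e e0; near=> y.
have : `|x - y| <= e by near: y; exact: cvgr_dist_le.
have [xy|/ltW xy] := leP x y.
  rewrite {1}distrC ger0_norm ?subr_ge0// => h; exact: le_trans (lip _ _ xy) h.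
rewrite ger0_norm ?subr_ge0// distrC => h; exact: le_trans (lip _ _ xy) h.
Unshelve. all: by end_near. Qed.

Lemma lt_horizon_radius m s : 0 <= m -> horizon_radius m < s ->
  0 < s /\ m < s + s ^+ 3.
Proof.
move=> m0 hs; have h0 := horizon_radius_ge0 m; split; first lra.
have := ler_cubicB _ _ h0 (ltW hs); rewrite horizon_radius_cubic max_r//; lra.
Qed.

Lemma horizon_radius_le m : 0 <= m -> horizon_radius m <= m.
Proof.
move=> m0; have := horizon_radius_cubic m; rewrite max_r//.
by have := exprn_ge0 3 (horizon_radius_ge0 m); lra.
Qed.

Lemma horizon_radius_lt : {in Num.nneg &, {homo @horizon_radius R : x y / x < y}}.
Proof.
move=> x y; rewrite !nnegrE => x0 y0 xy; rewrite ltNge; apply/negP => h.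
have := ler_cubicB _ _ (horizon_radius_ge0 y) h.
by rewrite !horizon_radius_cubic !max_r//; lra.
Qed.

(** * The volume form in the shell parameter *)

(** The volume form in the shell parameter, as a function of the radius. *)
Definition radial_density s : R :=
  8 * pi * (s ^+ 2 * Num.sqrt s / (1 + 3 * s ^+ 2)).

(** With [x = sqrt s] and [y = sqrt t] the claim is
    [x^5 / (1 + 3 x^4) < y^5 / (1 + 3 y^4)]; after clearing denominators the
    difference is [(y^5 - x^5) + 3 x^4 y^4 (y - x)]. *)
Lemma radial_density_lt : {in Num.nneg &, {homo radial_density : s t / s < t}}.
Proof.
move=> s t; rewrite !nnegrE => s0 t0 st; rewrite /radial_density.
rewrite ltr_pM2l ?mulr_gt0 ?pi_gt0//.
have [d1 d2] : 0 < 1 + 3 * s ^+ 2 /\ 0 < 1 + 3 * t ^+ 2.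
  by have := sqr_ge0 s; have := sqr_ge0 t; split; lra.
rewrite ltr_pdivrMr// [ltRHS]mulrAC ltr_pdivlMr//.
have xy : Num.sqrt s < Num.sqrt t by rewrite ltr_sqrt//; lra.
have := sqr_sqrtr s0; have := sqr_sqrtr t0; move: xy (sqrtr_ge0 s).
move: (Num.sqrt s) (Num.sqrt t) => x y xy x0 <- <-.
have y0 : 0 < y by lra.
have e5 : x ^+ 5 < y ^+ 5 by rewrite ltrXn2r.
have e9 : 0 <= x ^+ 4 * y ^+ 4 * (y - x) by rewrite !mulr_ge0 ?exprn_ge0//; lra.
rewrite -subr_gt0.
have -> : (y ^+ 2) ^+ 2 * y * (1 + 3 * (x ^+ 2) ^+ 2) -
  (x ^+ 2) ^+ 2 * x * (1 + 3 * (y ^+ 2) ^+ 2) =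
  (y ^+ 5 - x ^+ 5) + 3 * (x ^+ 4 * y ^+ 4 * (y - x)) by ring.
lra.
Qed.

Lemma radial_density_ge0 s : 0 <= radial_density s.
Proof.
apply: mulr_ge0; first by rewrite mulr_ge0 ?pi_ge0.
apply: divr_ge0; first by rewrite mulr_ge0 ?sqr_ge0 ?sqrtr_ge0.
by have := sqr_ge0 s; lra.
Qed.

Lemma radial_density_le s : 0 <= s -> radial_density s <= 8 * pi * Num.sqrt s.
Proof.
move=> s0; rewrite /radial_density ler_pM2l ?mulr_gt0 ?pi_gt0//.
have s2 := sqr_ge0 s; rewrite ler_pdivrMr; last lra.
rewrite mulrC ler_wpM2l ?sqrtr_ge0//; lra.
Qed.

Lemma radial_density_continuous : continuous radial_density.
Proof.
move=> s; rewrite /radial_density; apply: cvgM; first exact: cvg_cst.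
have c2 : (fun t => t ^+ 2) t @[t --> s] --> s ^+ 2 by apply: exprn_continuous.
apply: cvgM; last first.
  apply: cvgV; first by have := sqr_ge0 s; move=> ?; rewrite gt_eqF//; lra.
  by apply: cvgD; [exact: cvg_cst|apply: cvgM => //; exact: cvg_cst].
by apply: cvgM => //; exact: sqrt_continuous.
Qed.

(** The same density as a function of the shell parameter [w], whose radius [s]
    satisfies [s + s^3 = w^2 + m]. *)
Definition shell_density m w := radial_density (horizon_radius (w ^+ 2 + m)).

Lemma shell_density_continuous m : continuous (shell_density m).
Proof.
move=> w; rewrite /shell_density.
apply: (@continuous_comp _ _ _ (fun w => w ^+ 2 + m) (radial_density \o horizon_radius)).
  by apply: cvgD; [exact: exprn_continuous|exact: cvg_cst].
apply: continuous_comp; [exact: horizon_radius_continuous|exact: radial_density_continuous].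
Qed.

Lemma shell_density_lt m1 m2 w1 w2 : 0 <= m1 -> m1 <= m2 -> 0 <= w1 -> w1 <= w2 ->
  (m1 < m2) || (w1 < w2) -> shell_density m1 w1 < shell_density m2 w2.
Proof.
move=> m10 m12 w10 w12 h; rewrite /shell_density.
apply: radial_density_lt; rewrite ?nnegrE ?horizon_radius_ge0//.
have w1s := sqr_ge0 w1; have w12s : w1 ^+ 2 <= w2 ^+ 2 by rewrite lerXn2r// nnegrE; lra.
apply: horizon_radius_lt; rewrite ?nnegrE; [lra|lra|].
case/orP: h => h; first by lra.
have : w1 ^+ 2 < w2 ^+ 2 by rewrite ltrXn2r//; lra.
lra.
Qed.

(** * Calculus *)

Lemma continuous_primitive (f : R -> R) : continuous f ->
  exists P : R -> R, forall w, 0 <= w -> is_derive w 1 P (f w).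
Proof.
move=> cf; exists (fun w => \int[lebesgue_measure]_(t in `[-1, w]) f t) => w w0.
have itf : (@lebesgue_measure R).-integrable `[-1, w + 1] (EFin \o f).
  apply: continuous_compact_integrable; first exact: segment_compact.
  exact: continuous_subspaceT.
have w1 : w < w + 1 by lra.
have := @continuous_FTC1_closed R f (-1) w (w + 1) w1 itf.
have a1 : -1 < w by lra.
move=> /(_ a1 (cf w)) [d <-]; rewrite derive1E; exact/derivableP.
Qed.

Lemma MVT_itv (f df : R -> R) (a b : R) : a < b ->
  (forall x : R, a <= x <= b -> is_derive x 1 f (df x)) ->
  exists2 c, a < c < b & f b - f a = df c * (b - a).
Proof.
move=> ab dfE; have [x| |c] := @MVT R f df a b ab.
- by rewrite in_itv/= => /andP[? ?]; apply: dfE; apply/andP; split; exact: ltW.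
- apply: derivable_within_continuous => x; rewrite in_itv/= => /dfE h.
  exact: ex_derive.
- by rewrite in_itv/= => ? ?; exists c.
Qed.

(** Second fundamental theorem for a nonnegative integrand that may blow up at
    the left endpoint, by monotone convergence over the segments from [e n] to
    [b], with [e n] decreasing to [a]. *)
Lemma ge0_FTC2_singular (f P : R -> R) (a b : R) : a < b ->
  (forall x : R, a < x -> 0 <= f x) ->
  (forall x : R, a < x -> {for x, continuous f}) ->
  (forall x : R, a < x -> is_derive x 1 P (f x)) ->
  P x @[x --> a^'+] --> P a ->
  \int[lebesgue_measure]_(x in `[a, b]) f x = P b - P a.
Proof.
move=> ab f0 cf dP Pa.
have mf : measurable_fun `]a, b] f.
  apply: subspace_continuous_measurable_fun => //.
  apply: continuous_in_subspaceT => x; rewrite inE/= in_itv/= => /andP[ax _].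
  exact: cf.
rewrite /Rintegral -integral_itv_obnd_cbnd; last exact/measurable_EFinP.
pose e n : R := a + (b - a) * harmonic n.+1.
have e_gt n : a < e n by rewrite /e ltrDl mulr_gt0 ?subr_gt0 ?harmonic_gt0.
have e_lt n : e n < b.
  rewrite /e -ltrBrDl -[ltRHS]mulr1 ltr_pM2l ?subr_gt0// /harmonic/=.
  by rewrite invf_lt1// ltr1n.
have e_cvg : e n @[n --> \oo] --> a.
  rewrite -[X in _ --> X]addr0 -(mulr0 (b - a)).
  apply: cvgD; first exact: cvg_cst.
  apply: cvgM; first exact: cvg_cst.
  by rewrite (cvg_shiftS (@harmonic R)); exact: cvg_harmonic.
have bigU : `]a, b]%classic = \bigcup_n `[e n, b]%classic.
  apply/seteqP; split => [x/=|x [n _]/=]; rewrite !in_itv/= => /andP[x1 x2].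
    have [n xn] := @filter_ex _ _ _ _ (cvgr_lt a e_cvg _ x1).
    by exists n => //=; rewrite in_itv/= x2 ltW.
  by rewrite x2 (lt_le_trans (e_gt n) x1).
have Ie n : (\int[lebesgue_measure]_(x in `[e n, b]) (f x)%:E)%E = (P b - P (e n))%:E.
  have ge x : e n <= x -> a < x by exact: lt_le_trans.
  have Pc : {within `[e n, b], continuous P}.
    apply: derivable_within_continuous => x; rewrite in_itv/= => /andP[/ge/dP h _].
    exact: ex_derive.
  rewrite (continuous_FTC2 (F := P)) ?EFinB//.
  - apply: continuous_in_subspaceT => x; rewrite inE/= in_itv/= => /andP[/ge + _].
    exact: cf.
  - have /(continuous_within_itvP _ (e_lt n)) [_ h1 h2] := Pc; split => //.
    move=> x; rewrite in_itv/= => /andP[/ltW/ge/dP h _]; exact: ex_derive.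
  - move=> x; rewrite in_itv/= => /andP[/ltW/ge/dP h _].
    by rewrite derive1E derive_val.
have lim1 : (\int[lebesgue_measure]_(x in `[e n, b]) (f x)%:E)%E @[n --> \oo]
    --> (\int[lebesgue_measure]_(x in `]a, b]) (f x)%:E)%E.
  rewrite bigU; apply: ge0_nondecreasing_set_cvg_integral => //.
  - move=> m n mn; rewrite subsetEset; apply: subset_itvr; rewrite bnd_simp.
    rewrite /e lerD2l ler_pM2l ?subr_gt0// /harmonic/= lef_pV2 ?posrE//.
    by rewrite ler_nat.
  - move=> n; apply/measurable_EFinP; apply: measurable_funS mf => //.
    by apply: subset_itvr; rewrite bnd_simp.
  - move=> n x/=; rewrite in_itv/= lee_fin => /andP[h _]; apply: f0.
    exact: lt_le_trans h.
have lim2 : (\int[lebesgue_measure]_(x in `[e n, b]) (f x)%:E)%E @[n --> \oo]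
    --> (P b - P a)%:E.
  under eq_fun do rewrite Ie.
  apply: cvg_EFin; first exact: nearW.
  apply: cvgB; first exact: cvg_cst.
  have := (cvg_at_rightP P a (P a)).1 Pa; apply; split => //.
by rewrite (cvg_unique _ lim1 lim2).
Qed.

(** * The substitution *)

Definition volume_density m s : R := 4 * pi * s ^+ 2 / Num.sqrt (ads_potential m s).

Definition shell_parameter m s : R := Num.sqrt (s + s ^+ 3 - m).

Lemma volume_density_ge0 m s : 0 <= volume_density m s.
Proof. by apply: divr_ge0; [rewrite mulr_ge0 ?sqr_ge0 ?mulr_ge0 ?pi_ge0|exact: sqrtr_ge0]. Qed.

Lemma volume_density_continuous m s : 0 <= m -> horizon_radius m < s ->
  {for s, continuous (volume_density m)}.
Proof.
move=> m0 hs; have [s0 ms] := lt_horizon_radius _ _ m0 hs.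
apply: cvgM.
  by apply: cvgM; [exact: cvg_cst|exact: exprn_continuous].
apply: cvgV.
  by rewrite gt_eqF// sqrtr_gt0 ads_potentialE// divr_gt0//; lra.
apply: (@continuous_comp _ _ _ (ads_potential m) (@Num.sqrt R)); last exact: sqrt_continuous.
apply: cvgB.
  by apply: cvgD; [exact: cvg_cst|exact: exprn_continuous].
by apply: cvgM; [exact: cvg_cst|apply: cvgV => //; rewrite gt_eqF].
Qed.

Lemma is_derive_shell_parameter m s : m < s + s ^+ 3 ->
  is_derive s 1 (shell_parameter m) ((1 + 3 * s ^+ 2) / (2 * shell_parameter m s)).
Proof.
move=> ms.
have d1 : is_derive s 1 (fun s => s + s ^+ 3 - m) (1 + 3 * s ^+ 2).
  by apply: is_derive_eq; rewrite /GRing.scale/=; ring.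
have p0 : 0 < s + s ^+ 3 - m by rewrite subr_gt0.
have := @is_derive1_comp _ _ (fun s => s + s ^+ 3 - m) s _ _ (is_derive1_sqrt p0) d1.
by rewrite mulrC.
Qed.

(** The chain rule behind the substitution [w = shell_parameter m s]. *)
Lemma is_derive_shell_primitive (P : R -> R) m s :
  (forall w, 0 <= w -> is_derive w 1 P (shell_density m w)) ->
  0 <= m -> horizon_radius m < s ->
  is_derive s 1 (P \o shell_parameter m) (volume_density m s).
Proof.
move=> dP m0 hs; have [s0 ms] := lt_horizon_radius _ _ m0 hs.
have dW := is_derive_shell_parameter _ _ ms.
have dPW := @is_derive1_comp _ P (shell_parameter m) s _ _ (dP _ (sqrtr_ge0 _)) dW.
apply: is_derive_eq.
have p0 : 0 < s + s ^+ 3 - m by rewrite subr_gt0.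
rewrite /shell_density /shell_parameter sqr_sqrtr ?(ltW p0)// subrK.
rewrite cubic_horizon_radius ?(ltW s0)// /radial_density /volume_density.
rewrite ads_potentialE// sqrtrM ?(ltW p0)// sqrtrV ?(ltW s0)//.
have q0 : 0 < Num.sqrt (s + s ^+ 3 - m) by rewrite sqrtr_gt0.
have r0 : 0 < Num.sqrt s by rewrite sqrtr_gt0.
have := sqr_ge0 s; move: (Num.sqrt s) (Num.sqrt _) r0 q0 => u v u0 v0 s2.
by field; rewrite !gt_eqF//; lra.
Qed.

Lemma volume_integralE (P : R -> R) m r :
  (forall w, 0 <= w -> is_derive w 1 P (shell_density m w)) ->
  0 <= m -> horizon_radius m < r ->
  \int[lebesgue_measure]_(s in `[horizon_radius m, r]) volume_density m s =
  P (shell_parameter m r) - P 0.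
Proof.
move=> dP m0 hr.
have W0 : shell_parameter m (horizon_radius m) = 0.
  by rewrite /shell_parameter horizon_radius_cubic max_r// subrr sqrtr0.
rewrite -W0; apply: (ge0_FTC2_singular (volume_density m) (P \o shell_parameter m)) => //.
- by move=> x _; exact: volume_density_ge0.
- by move=> x; exact: volume_density_continuous.
- by move=> x; exact: is_derive_shell_primitive.
- apply: cvg_at_right_filter; apply: continuous_comp.
    apply: (@continuous_comp _ _ _ (fun s : R => s + s ^+ 3 - m) (@Num.sqrt R)).
      apply: cvgB; last exact: cvg_cst.
      by apply: cvgD; [exact: cvg_id|exact: exprn_continuous].
    exact: sqrt_continuous.
  apply: differentiable_continuous; apply/derivable1_diffP; apply: ex_derive.
  by apply: dP; rewrite W0.
Qed.

Lemma volume_excessE (P P0 : R -> R) m r :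
  (forall w, 0 <= w -> is_derive w 1 P (shell_density m w)) ->
  (forall w, 0 <= w -> is_derive w 1 P0 (shell_density 0 w)) ->
  0 <= m -> horizon_radius m < r ->
  volume_excess m r = (P (shell_parameter m r) - P 0) -
    (P0 (shell_parameter 0 r) - P0 0).
Proof.
move=> dP dP0 m0 hr; rewrite -volume_integralE//.
have h0 : horizon_radius 0 = 0 :> R by exact: horizon_radius_le0.
have r0 : 0 < r by exact: le_lt_trans (horizon_radius_ge0 m) hr.
rewrite -volume_integralE ?h0// /volume_excess.
congr (_ - _); apply: eq_Rintegral => s _.
by rewrite /volume_density /ads_potential mul0r subr0.
Qed.

Lemma volume_densityB_ge0 m s : 0 <= m -> horizon_radius m < s ->
  volume_density 0 s <= volume_density m s.
Proof.
move=> m0 hs; have [s0 ms] := lt_horizon_radius _ _ m0 hs.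
rewrite ler_wpM2l ?mulr_ge0 ?pi_ge0 ?exprn_ge0 ?(ltW s0)//.
have pm : 0 < ads_potential m s by rewrite ads_potentialE// divr_gt0//; lra.
have le : ads_potential m s <= ads_potential 0 s.
  have si : 0 <= s^-1 by rewrite invr_ge0 ltW.
  by rewrite /ads_potential mul0r; have := mulr_ge0 m0 si; lra.
rewrite lef_pV2 ?posrE ?sqrtr_gt0//; last exact: lt_le_trans le.
by rewrite ler_wsqrtr.
Qed.

(** Write [p] and [q] for the two square roots.  Then [q^2 - p^2 = m/s], so
    [1/p - 1/q = (m/s) / ((p + q) p q)], and both roots are at least [s] as soon
    as [m/s <= 1]. *)
Lemma volume_densityB_le m s : 0 <= m -> m < s ->
  volume_density m s - volume_density 0 s <= 4 * pi * m / s ^+ 2.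
Proof.
move=> m0 ms; have s0 : 0 < s by lra.
rewrite /volume_density.
have ms1 : m / s <= 1 by rewrite ler_pdivrMr//; lra.
have ms0 : 0 <= m / s by rewrite divr_ge0//; lra.
have E0 : ads_potential 0 s = ads_potential m s + m / s.
  by rewrite /ads_potential; ring.
have pm : s ^+ 2 <= ads_potential m s by rewrite /ads_potential; lra.
have p : s <= Num.sqrt (ads_potential m s).
  by rewrite -[leLHS](ger0_norm (ltW s0)) -sqrtr_sqr ler_wsqrtr.
have q : s <= Num.sqrt (ads_potential 0 s).
  by apply: le_trans p _; rewrite ler_wsqrtr// E0; lra.
have pE : Num.sqrt (ads_potential m s) ^+ 2 = ads_potential m s.
  by rewrite sqr_sqrtr//; have := sqr_ge0 s; lra.
have qE : Num.sqrt (ads_potential 0 s) ^+ 2 = ads_potential m s + m / s.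
  by rewrite sqr_sqrtr//; have := sqr_ge0 s; lra.
move: (Num.sqrt (ads_potential m s)) (Num.sqrt (ads_potential 0 s)) p q pE qE.
move=> p q ps qs pE qE.
have -> : 4 * pi * s ^+ 2 / p - 4 * pi * s ^+ 2 / q =
   4 * pi * (s ^+ 2 * ((q - p) / (p * q))).
  by field; rewrite !gt_eqF//; lra.
rewrite -[leRHS]mulrA ler_pM2l ?mulr_gt0 ?pi_gt0//.
have -> : q - p = m / s / (p + q).
  have pq : p + q != 0 by rewrite gt_eqF//; lra.
  by apply: (mulIf pq); rewrite divfK//; move: qE; rewrite -pE; lra.
have -> : s ^+ 2 * (m / s / (p + q) / (p * q)) = m * (s / ((p + q) * (p * q))).
  by field; rewrite !gt_eqF//; lra.
rewrite ler_wpM2l// ler_pdivrMr ?mulr_gt0 //; [|lra..].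
rewrite mulrC ler_pdivlMr ?exprn_gt0// -exprS.
have h : s ^+ 2 <= p * q by rewrite expr2 ler_pM// ltW.
have : s * s ^+ 2 <= (p + q) * (p * q) by apply: ler_pM => //; [lra|exact: sqr_ge0|lra].
by rewrite -exprS.
Qed.

(** * Convergence of the volume excess *)

(** The derivative of the excess is [volume_density m - volume_density 0], which
    lies between [0] and [4 pi m / r^2]; the latter is the derivative of
    [- 4 pi m / r]. *)
Lemma volume_excess_increment m x y : 0 <= m -> m < x -> x <= y ->
  0 <= volume_excess m y - volume_excess m x <= 4 * pi * m * (x^-1 - y^-1).
Proof.
move=> m0 mx; rewrite le_eqVlt => /predU1P[->|xy]; first by rewrite !subrr mulr0 lexx.
have hm := horizon_radius_le _ m0.
have [P dP] := continuous_primitive _ (shell_density_continuous m).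
have [P0 dP0] := continuous_primitive _ (shell_density_continuous (0 : R)).
rewrite !(volume_excessE P P0)//; [|lra..].
set S := shell_parameter; pose G r := P (S m r) - P0 (S 0 r).
have -> : P (S m y) - P 0 - (P0 (S 0 y) - P0 0) -
  (P (S m x) - P 0 - (P0 (S 0 x) - P0 0)) = G y - G x by rewrite /G; ring.
have h0 : horizon_radius 0 = 0 :> R by exact: horizon_radius_le0.
have dG r : m < r -> is_derive r 1 G (volume_density m r - volume_density 0 r).
  move=> mr; have r0 : horizon_radius 0 < r by rewrite h0; lra.
  have d0 := is_derive_shell_primitive P0 0 r dP0 (lexx 0) r0.
  have d1 := is_derive_shell_primitive P m r dP m0 (le_lt_trans hm mr).
  exact: (is_deriveB d1 d0).
apply/andP; split.
  have [r /andP[xr ry]|r /andP[xr ry] ->] :=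
    MVT_itv G (fun r => volume_density m r - volume_density 0 r) x y xy.
    by apply: dG; lra.
  rewrite mulr_ge0 ?subr_ge0 ?(ltW xy)//; apply: volume_densityB_ge0 => //; lra.
(* For the upper bound, [H] is nonincreasing. *)
pose H r := G r + 4 * pi * m * r^-1.
have dH r : m < r -> is_derive r 1 H
    (volume_density m r - volume_density 0 r - 4 * pi * m / r ^+ 2).
  move=> mr; have d1 := dG _ mr.
  have rn0 : r != 0 by rewrite gt_eqF//; lra.
  have d2 : is_derive r 1 (fun r : R => r^-1) (- (r ^- 2)).
    by have := @is_deriveV R id r 1 1 rn0 (is_derive_id _ _); rewrite /GRing.scale/= mulr1.
  have d3 := is_deriveD d1 (is_deriveZ (4 * pi * m) d2).
  apply: (@is_derive_eq _ _ _ _ _ _ _ _ d3).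
  by rewrite /GRing.scale/= mulrN.
have [r /andP[xr ry]|r /andP[xr ry] HE] := 
    MVT_itv H (fun r => volume_density m r - volume_density 0 r - 4 * pi * m / r ^+ 2) x y xy.
  by apply: dH; lra.
have : H y - H x <= 0.
  rewrite HE mulr_le0_ge0 ?subr_ge0 ?(ltW xy)//.
  have mr : m < r by lra.
  by have := volume_densityB_le _ _ m0 mr; lra.
rewrite /H mulrBr; lra.
Qed.

Lemma volume_excess_cvg m : 0 <= m -> cvg (volume_excess m r @[r --> +oo]).
Proof.
move=> m0; pose A := m + 1; have A0 : 0 < A by rewrite /A; lra.
(* Freezing the excess below radius [A > m] makes it monotone on the whole line
   without changing its limit. *)
pose g r := volume_excess m (Num.max A r).
have gc : cvg (g r @[r --> +oo]).
  apply/cvg_ex; eexists; apply: nondecreasing_cvgr.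
    move=> x y xy; have mx : m < Num.max A x by rewrite lt_max /A; apply/orP; left; lra.
    have Mxy : Num.max A x <= Num.max A y by rewrite ge_max !le_max lexx xy orbT.
    by have /andP[+ _] := volume_excess_increment _ _ _ m0 mx Mxy; rewrite subr_ge0.
  exists (volume_excess m A + 4 * pi * m * A^-1) => _ [r _ <-].
  have mA : m < A by rewrite /A; lra.
  have Ar : A <= Num.max A r by rewrite le_max lexx.
  have /andP[_] := volume_excess_increment _ _ _ m0 mA Ar.
  have : 0 <= 4 * pi * m * (Num.max A r)^-1.
    by rewrite mulr_ge0 ?mulr_ge0 ?pi_ge0// invr_ge0; lra.
  rewrite /g mulrBr; lra.
move/cvg_ex: gc => [l gl]; apply/cvg_ex; exists l; apply: cvg_trans gl.
apply: near_eq_cvg; near=> r.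
have Ar : A <= r by near: r; exact: nbhs_pinfty_ge (num_real _).
by rewrite /g max_r.
Unshelve. all: by end_near. Qed.

(** * Comparison of two masses *)

(** By the mean value theorem the difference is at most
    [shell_density m1 W1 * (W1 - W2)].  The density at [W1] is [F r], of order
    [sqrt r], whereas [W1 - W2 = (m2 - m1) / (W1 + W2)] is of order
    [r ^ (- 3/2)]. *)
Lemma shell_parameter_shift_le (P : R -> R) m1 m2 r :
  (forall w, 0 <= w -> is_derive w 1 P (shell_density m1 w)) ->
  0 <= m1 -> m1 < m2 -> 1 <= r -> m2 < r ->
  P (shell_parameter m1 r) - P (shell_parameter m2 r) <= 8 * pi * (m2 - m1) / r.
Proof.
move=> dP m10 m12 r1 mr.
have r3 : r <= r ^+ 3 by apply: ler_eXnr.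
set W1 := shell_parameter m1 r; set W2 := shell_parameter m2 r.
have W1E : W1 ^+ 2 = r + r ^+ 3 - m1 by rewrite sqr_sqrtr//; lra.
have W2E : W2 ^+ 2 = r + r ^+ 3 - m2 by rewrite sqr_sqrtr//; lra.
have W20 : 0 <= W2 by exact: sqrtr_ge0.
have W21 : W2 < W1 by rewrite ltr_sqrt; lra.
have [w /andP[w2 _]|w /andP[w2 w1] ->] := MVT_itv P (shell_density m1) _ _ W21.
  by apply: dP; lra.
(* [W1^2 = r^3 + (r - m1)], and [m1 < r]. *)
have rW : r * Num.sqrt r <= W1.
  have r0 : 0 <= r by lra.
  rewrite -{1}(ger0_norm r0) -sqrtr_sqr -sqrtrM ?sqr_ge0// ler_wsqrtr// -exprSr; lra.
have dw : shell_density m1 w <= 8 * pi * Num.sqrt r.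
  have w0 : 0 <= w by lra.
  have := shell_density_lt _ _ _ _ m10 (lexx m1) w0 (ltW w1).
  rewrite w1 orbT => /(_ isT) /ltW h; apply: le_trans h _.
  have r0 : 0 <= r by lra.
  rewrite /shell_density W1E subrK cubic_horizon_radius//.
  exact: radial_density_le.
have dW : W1 - W2 <= (m2 - m1) / W1.
  rewrite ler_pdivlMr; last lra.
  have : (W1 - W2) * (W1 + W2) = m2 - m1.
    by rewrite -subr_sqr W1E W2E; ring.
  have : 0 <= (W1 - W2) * W2 by rewrite mulr_ge0//; lra.
  lra.
have s0 : 0 < Num.sqrt r by rewrite sqrtr_gt0; lra.
apply: (@le_trans _ _ (8 * pi * Num.sqrt r * ((m2 - m1) / (r * Num.sqrt r)))).
  apply: ler_pM => //; [|lra|].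
    exact: radial_density_ge0.
  apply: le_trans dW _; rewrite ler_pM2l ?subr_gt0//.
  by rewrite lef_pV2 ?posrE ?mulr_gt0//; lra.
rewrite le_eqVlt; apply/orP; left; apply/eqP; field.
by rewrite !gt_eqF//; lra.
Qed.

(** [D = Phi_m2 - Phi_m1] is strictly increasing, hence contributes at least
    [e = D 1 - D 0] once the shell parameter is at least 1; the shift between the
    two shell parameters costs at most [K / r], which is at most [e / 2] for
    [r >= 2 K / e]. *)
Lemma volume_excess_gap m1 m2 : 0 <= m1 -> m1 < m2 ->
  exists2 d : R, 0 < d &
    \forall r \near +oo, volume_excess m1 r + d <= volume_excess m2 r.
Proof.
move=> m10 m12; have m20 : 0 <= m2 by lra.
have [P1 dP1] := continuous_primitive _ (shell_density_continuous m1).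
have [P2 dP2] := continuous_primitive _ (shell_density_continuous m2).
have [P0 dP0] := continuous_primitive _ (shell_density_continuous (0 : R)).
pose D w := P2 w - P1 w.
have dD w : 0 <= w -> is_derive w 1 D (shell_density m2 w - shell_density m1 w).
  by move=> w0; have := is_deriveB (dP2 _ w0) (dP1 _ w0).
have Dlt x y : 0 <= x -> x < y -> D x < D y.
  move=> x0 xy; rewrite -subr_gt0.
  have [w /andP[xw _]|w /andP[xw _] ->] :=
    MVT_itv D (fun w => shell_density m2 w - shell_density m1 w) _ _ xy.
    by apply: dD; lra.
  have w0 : 0 <= w by lra.
  rewrite mulr_gt0 ?subr_gt0//; apply: shell_density_lt => //; [lra|].
  by rewrite m12.
pose e := D 1 - D 0; have e0 : 0 < e by rewrite subr_gt0 Dlt// ltr01.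
exists (e / 2); first by rewrite divr_gt0.
pose K := 8 * pi * (m2 - m1); have K0 : 0 < K by rewrite mulr_gt0 ?mulr_gt0 ?pi_gt0 ?subr_gt0.
near=> r.
have r1 : 1 <= r by near: r; exact: nbhs_pinfty_ge.
have mr : m2 < r by near: r; exact: nbhs_pinfty_gt (num_real _).
have rK : 2 * K / e <= r by near: r; exact: nbhs_pinfty_ge (num_real _).
have h1 := horizon_radius_le _ m10; have h2 := horizon_radius_le _ m20.
rewrite (volume_excessE P1 P0)// ?(volume_excessE P2 P0)//; [|lra..].
have := shell_parameter_shift_le P1 m1 m2 r dP1 m10 m12 r1 mr.
have : K / r <= e / 2.
  rewrite ler_pdivrMr; last lra.
  move: rK; rewrite ler_pdivrMr//; lra.
have : D 1 <= D (shell_parameter m2 r).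
  have : 1 <= shell_parameter m2 r.
    have r3 : r <= r ^+ 3 by apply: ler_eXnr.
    by rewrite -[leLHS]sqrtr1 ler_wsqrtr//; lra.
  rewrite le_eqVlt => /predU1P[<-//|h]; apply/ltW/Dlt => //; lra.
rewrite -/K /e /D; lra.
Unshelve. all: by end_near. Qed.

End RenormalizedVolume.

Theorem mainTheorem2 (R : realType) :
  (forall m : R, 0 < m -> cvg (volume_excess m r @[r --> +oo])) /\
  (forall m1 m2 : R, 0 < m1 -> m1 < m2 ->
     renormalized_volume m1 < renormalized_volume m2).
Proof.
split=> [m /ltW|m1 m2 /ltW m10 m12]; first exact: volume_excess_cvg.
have m20 : 0 <= m2 by exact: le_trans (ltW m12).
have c1 := volume_excess_cvg _ m10; have c2 := volume_excess_cvg _ m20.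
have [d d0 gap] := volume_excess_gap _ _ m10 m12.
have le : renormalized_volume m1 + d <= renormalized_volume m2.
  apply: (@ler_cvg_to _ _ _ _ (fun r => volume_excess m1 r + d) (volume_excess m2)) gap.
    exact: (cvgD c1 (cvg_cst d)).
  exact: c2.
by apply: lt_le_trans le; rewrite ltrDl.
Qed.
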